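(* Let $p$ be a distance tariff with an increasing price function $P:\mathbb{R}_{\ge 0}\to\mathbb{R}_{\ge 0}$. (i) For any two stations, a cheapest path and hence a cheapest standard ticket between them can be computed in polynomial time. (ii) If $P$ is subadditive on $\mathbb{R}_{>0}$, then a cheapest ticket between any two stations can be computed in polynomial time.
   Context: ''Increasing'' means non-decreasing. A PTN is a finite, simple, connected, undirected graph $(V,E)$, here with a positive physical length assigned to each edge. A path is a finite sequence of (not necessarily distinct) nodes with consecutive nodes adjacent; $\mathcal{W}$ is the set of all paths; $l(W)$ is the sum of the edge lengths along $W$. A fare structure is a function $p:\mathcal{W}\to\mathbb{R}_{\ge 0}$; it is a distance tariff with respect to $P$ if $p(W)=P(l(W))$ for all $W\in\mathcal{W}$. A ticket of $W\in\mathcal{W}$ is a finite sequence of paths $T=(H_1,\dots,H_t)$ such that $W$ is a concatenation $W_1+\dots+W_t$ of subpaths with $W_j$ a subpath of $H_j$ for each $j$; its price is $\sum_{j=1}^t p(H_j)$. The standard ticket of $W$ is $(W)$. A cheapest ticket (resp. cheapest standard ticket) from $x$ to $y$ is one of minimum price among all tickets (resp. standard tickets) of all $x$-$y$-paths; a cheapest path from $x$ to $y$ is an $x$-$y$-path $W$ minimizing $p(W)$. *)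

(* Defs.v *)
From mathcomp Require Import all_boot all_order all_algebra reals.

Set Implicit Arguments.
Unset Strict Implicit.
Unset Printing Implicit Defensive.

Import Order.TTheory GRing.Theory Num.Theory.
Local Open Scope ring_scope.

(* [len] is only meaningful on adjacent pairs. *)
Record ptn (R : realType) := Ptn {
  station :> finType;
  adj : rel station;
  len : station -> station -> R;
  adj_sym : symmetric adj;
  adj_irr : irreflexive adj;
  adj_connected : forall x y, connect adj x y;
  len_sym : forall x y, adj x y -> len x y = len y x;
  len_gt0 : forall x y, adj x y -> 0 < len x y
}.

Section Tariffs.
Variables (R : realType) (N : ptn R).
Implicit Types (W H : seq N) (T : seq (seq N)) (p : seq N -> R) (P : R -> R).

Definition is_path W : bool := (W != [::]) && sorted (@adj R N) W.

Definition is_path_between (x y : N) W : bool :=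
  [&& is_path W, ohead W == Some x & last x W == y].

Definition path_len W : R :=
  if W is x :: s then \sum_(d <- pairmap (@len R N) x s) d else 0.

(* Fare structures are total on [seq N]; only their values on paths matter. *)
Definition fare_structure p : Prop := forall W, is_path W -> 0 <= p W.

Definition distance_tariff P p : Prop :=
  forall W, is_path W -> p W = P (path_len W).

(* Consecutive pieces share their common end node, which occurs once in the
   concatenation; a concatenation has at least one piece. *)
Inductive concatenation : seq (seq N) -> seq N -> Prop :=
| Concat1 W : concatenation [:: W] W
| ConcatS W (x : N) Ws W' :
    concatenation Ws (x :: W') ->
    concatenation (rcons W x :: Ws) (W ++ x :: W').

Definition is_ticket W T : Prop :=
  all is_path T /\
  exists Ws : seq (seq N),
    [/\ concatenation Ws W, all is_path Ws & all2 (@infix N) Ws T].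

Definition ticket_price p T : R := \sum_(H <- T) p H.

Definition standard_ticket W : seq (seq N) := [:: W].

Definition cheapest_path p (x y : N) W : Prop :=
  is_path_between x y W /\
  forall W', is_path_between x y W' -> p W <= p W'.

Definition cheapest_standard_ticket p (x y : N) T : Prop :=
  (exists2 W, is_path_between x y W & T = standard_ticket W) /\
  forall W', is_path_between x y W' ->
    ticket_price p T <= ticket_price p (standard_ticket W').

Definition cheapest_ticket p (x y : N) T : Prop :=
  (exists2 W, is_path_between x y W & is_ticket W T) /\
  forall W' T', is_path_between x y W' -> is_ticket W' T' ->
    ticket_price p T <= ticket_price p T'.

End Tariffs.

(* A function from the nonnegative reals to the nonnegative reals is a total
   [P : R -> R] of which only the values on nonnegative arguments matter. *)
Definition price_function (R : realType) (P : R -> R) : Prop :=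
  forall a, 0 <= a -> 0 <= P a.

Definition increasing_price (R : realType) (P : R -> R) : Prop :=
  forall a b, 0 <= a -> a <= b -> P a <= P b.

Definition subadditive_gt0 (R : realType) (P : R -> R) : Prop :=
  forall a b, 0 < a -> 0 < b -> P (a + b) <= P a + P b.

(* Computation model: structured programs of a unit-cost random access machine
   with a memory of natural numbers (with indirect addressing) and a memory of
   real numbers, both unbounded. There are no real constants but 0 and no
   multiplication or rounding: after t steps every natural number has O(t) more
   bits than the input, and every real is an integer combination of the input
   reals with coefficients of O(t) bits. Hence a polynomial number of steps is
   also a polynomial number of bit operations when the input reals are
   rational. *)
Inductive nexp : Type :=
| NConst of nat
| NLoad of nexp
| NAdd of nexp & nexp
| NSub of nexp & nexp.

Inductive rexp : Type :=
| RZero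
| RLoad of nexp
| RAdd of rexp & rexp
| RSub of rexp & rexp.

Inductive bexp : Type :=
| BNLe of nexp & nexp
| BRLe of rexp & rexp
| BNot of bexp
| BAnd of bexp & bexp.

Inductive program : Type :=
| Skip
| NStore of nexp & nexp
| RStore of nexp & rexp
| Seq of program & program
| If of bexp & program & program
| While of bexp & program.

Section Semantics.
Variable R : realType.

Record state := State { nmem : nat -> nat; rmem : nat -> R }.
Implicit Type s : state.

Fixpoint neval s (e : nexp) : nat :=
  match e with
  | NConst n => n
  | NLoad a => nmem s (neval s a)
  | NAdd e1 e2 => (neval s e1 + neval s e2)%N
  | NSub e1 e2 => (neval s e1 - neval s e2)%N
  end.

Fixpoint reval s (e : rexp) : R :=
  match e with
  | RZero => 0
  | RLoad a => rmem s (neval s a)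
  | RAdd e1 e2 => reval s e1 + reval s e2
  | RSub e1 e2 => reval s e1 - reval s e2
  end.

Fixpoint beval s (b : bexp) : bool :=
  match b with
  | BNLe e1 e2 => (neval s e1 <= neval s e2)%N
  | BRLe e1 e2 => reval s e1 <= reval s e2
  | BNot b1 => ~~ beval s b1
  | BAnd b1 b2 => beval s b1 && beval s b2
  end.

(* [exec c s t s']: from [s], [c] halts in [s'] after [t] steps. One step is
   charged per assignment and per test; the expressions in a fixed program
   have bounded size, so this is unit cost up to a constant factor. *)
Inductive exec : program -> state -> nat -> state -> Prop :=
| ExSkip s : exec Skip s 1 s
| ExNStore a e s :
    exec (NStore a e) s 1
      (State [eta nmem s with neval s a |-> neval s e] (rmem s))
| ExRStore a e s :
    exec (RStore a e) s 1
      (State (nmem s) [eta rmem s with neval s a |-> reval s e])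
| ExSeq c1 c2 s t1 s1 t2 s2 :
    exec c1 s t1 s1 -> exec c2 s1 t2 s2 -> exec (Seq c1 c2) s (t1 + t2) s2
| ExIfTrue b c1 c2 s t s' :
    beval s b -> exec c1 s t s' -> exec (If b c1 c2) s t.+1 s'
| ExIfFalse b c1 c2 s t s' :
    ~~ beval s b -> exec c2 s t s' -> exec (If b c1 c2) s t.+1 s'
| ExWhileFalse b c s :
    ~~ beval s b -> exec (While b c) s 1 s
| ExWhileTrue b c s t1 s1 t2 s2 :
    beval s b -> exec c s t1 s1 -> exec (While b c) s1 t2 s2 ->
    exec (While b c) s (t1 + t2).+1 s2.

Section Algorithms.
Variable N : ptn R.

Definition node_code (x : N) : nat := enum_rank x.

(* Every edge is listed in both directions. *)
Definition arcs : seq (N * N) := [seq a <- enum {: N * N} | adj a.1 a.2].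

(* The price function is not part of the input: a program that never queries
   it is also one for any way of presenting a real function to a machine. *)
Definition input_state (x y : N) : state :=
  State
    (nth 0%N ([:: #|N|; size arcs; node_code x; node_code y] ++
              flatten [seq [:: node_code a.1; node_code a.2] | a <- arcs]))
    (nth 0 [seq len a.1 a.2 | a <- arcs]).

Definition network_size : nat := (#|N| + size arcs)%N.

Definition path_code (W : seq N) : seq nat := size W :: map node_code W.

Definition ticket_code (T : seq (seq N)) : seq nat :=
  size T :: flatten (map path_code T).

(* The codes above are self-delimiting, so the contents of the memory from
   address 0 on determine the output. *)
Definition returns (c : program) (x y : N) (out : seq nat) : Prop :=
  exists t s, exec c (input_state x y) t s /\
    forall i, (i < size out)%N -> nmem s i = nth 0%N out i.

End Algorithms.

Definition polynomial_time (c : program) : Prop :=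
  exists k d : nat, forall (N : ptn R) (x y : N),
    exists t s, exec c (input_state x y) t s /\
      (t <= k * network_size N ^ d + k)%N.

End Semantics.

(* Main.v *)
Require Import Defs.
From mathcomp Require Import all_boot all_order all_algebra reals.
From mathcomp Require Import zify lra.

Set Implicit Arguments.
Unset Strict Implicit.
Unset Printing Implicit Defensive.

Import Order.TTheory GRing.Theory Num.Theory.
Local Open Scope ring_scope.

(** Since the price function is increasing, a shortest path is a cheapest path,
    whatever that function is; so the machine only has to find shortest paths
    and never needs to evaluate prices.

    The standard ticket of a shortest path is also a cheapest ticket when the
    price function [P] is subadditive: for a ticket [H_1, .., H_t] of a path
    cut into [W_1, .., W_t], monotonicity gives [P (l H_j) >= P (l W_j)], and
    subadditivity gives that the sum of the [P (l W_j)] is at least [P] of the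
    total length ([ticket_price_ge]). Pieces of length [0], where subadditivity
    is not assumed, can be dropped because prices are nonnegative. Hence one
    program serves for standard and for general tickets.

    Shortest paths are computed by the Bellman-Ford method, directed towards
    the target [y]. Each node carries a tentative distance to [y] and the next
    node on a path to [y]. After [k] rounds of relaxing every arc, the label of
    a node is at most the length of each of its walks to [y] with at most [k]
    arcs ([iter_relax_below]); as loops can be cut out of walks, [#|N|] rounds
    suffice ([final_below]). Conversely, labels strictly decrease from each
    node to its successor, by at least the length of the arc between them, so
    that the successors lead to [y] along a path that is no longer than the
    label ([successor_path]).
    There are [#|N|] relaxations of each arc in all.

    The program is verified with a total correctness calculus that carries a
    bound on the number of steps ([runs]). Its loops are matched with
    iterations of the functions on labellings by the memory invariant
    [stored]. *)

(** * Lengths of paths *)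

Arguments path_len : simpl never.

Section Lengths.
Variables (R : realType) (N : ptn R).
Implicit Types (W H s : seq N) (x y u v : N).

Lemma is_path_betweenP x y W :
  reflect (exists s, [/\ W = x :: s, path (@adj R N) x s & last x s = y])
          (is_path_between x y W).
Proof.
apply: (iffP and3P) => [[/andP[Wn0 sW] hW /eqP lW] | [s [-> ps <-]]].
  case: W Wn0 sW hW lW => // z s _ /= ps /eqP[zx] ls.
  by subst z; exists s.
by split; rewrite //= /is_path /= ps.
Qed.

Lemma path_len_cons x u s : path_len (x :: u :: s) = len x u + path_len (u :: s).
Proof. by rewrite /path_len /= big_cons. Qed.

Lemma path_len1 x : path_len [:: x] = 0 :> R.
Proof. by rewrite /path_len /= big_nil. Qed.

Lemma path_len_cat W x s :
  path_len (W ++ x :: s) = path_len (rcons W x) + path_len (x :: s).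
Proof.
elim: W => [|u [|v W] IH] /=; first by rewrite path_len1 add0r.
  by rewrite !path_len_cons path_len1 addr0.
by rewrite !path_len_cons -addrA; congr (_ + _); exact: IH.
Qed.

Lemma path_len_ge0 W : sorted (@adj R N) W -> 0 <= path_len W.
Proof.
case: W => [//|x s]; elim: s x => [|u s IH] x /=; first by rewrite path_len1.
case/andP=> axu ps; rewrite path_len_cons addr_ge0 ?IH //.
exact/ltW/len_gt0.
Qed.

Lemma path_len_suffix W x s :
  sorted (@adj R N) (W ++ x :: s) -> path_len (x :: s) <= path_len (W ++ x :: s).
Proof.
rewrite -cat_rcons => /cat_sorted2[sW _].
by rewrite cat_rcons path_len_cat lerDr path_len_ge0.
Qed.

(** What precedes and what follows an infix of a path are themselves paths, so
    their lengths are not negative. *)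
Lemma path_len_infix W H :
  W != [::] -> is_path H -> infix W H -> path_len W <= path_len H.
Proof.
move=> Wn0 /andP[_ sH] /infixP[a [b eH]]; subst H.
case: W Wn0 sH => // w W _ sH.
apply: (le_trans _ (path_len_suffix (s := W ++ b) sH)).
have [_ {sH}] := cat_sorted2 sH.
rewrite -cat_cons lastI cat_rcons path_len_cat -cat_rcons => sWb.
have sb : sorted (@adj R N) (last w W :: b).
  by move: sWb; rewrite cat_rcons => /cat_sorted2[].
by rewrite lerDl path_len_ge0.
Qed.

(** Cutting out the loops of a walk cannot lengthen it. *)
Lemma simple_shorter_path x s :
  path (@adj R N) x s ->
  exists s', [/\ path (@adj R N) x s', last x s' = last x s, uniq (x :: s')
               & path_len (x :: s') <= path_len (x :: s)].
Proof.
elim: s x => [|u s IH] x; first by exists [::].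
move=> /= /andP[axu /IH[s' [ps' ls' us' hs']]].
have xu0 : 0 < len x u by exact: len_gt0.
(* If [x] recurs, the loop at [x] can be cut out, leaving a suffix. *)
have [xs'|xs'] := boolP (x \in u :: s').
  have [p1 [p2 ep]] : exists p1 p2, u :: s' = p1 ++ x :: p2.
    by case/splitPr: xs' => p1 p2; exists p1, p2.
  have sx : sorted (@adj R N) (p1 ++ x :: p2) by rewrite -ep.
  exists p2; split.
  - by have [] := cat_sorted2 sx.
  - by rewrite -ls' -[last u s']/(last x (u :: s')) ep last_cat.
  - by move: us'; rewrite ep cat_uniq => /and3P[].
  - rewrite path_len_cons; apply: (le_trans (path_len_suffix sx)).
    by rewrite -ep; lra.
exists (u :: s'); split => //=; rewrite ?axu //.
  by rewrite xs'.
by rewrite !path_len_cons lerD2l.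
Qed.

End Lengths.

(** * Prices of tickets *)

Section Tickets.
Variables (R : realType) (N : ptn R) (P : R -> R) (p : seq N -> R).
Hypotheses (P0 : price_function P) (Pincr : increasing_price P).
Hypothesis (pP : distance_tariff P p).

(** Subadditivity is only available for positive lengths. If the first piece or
    the rest has length [0], it can be dropped, as its price is not negative. *)
Lemma concatenation_price Ws W :
  subadditive_gt0 P -> concatenation Ws W -> all (@is_path R N) Ws ->
  0 <= path_len W /\ P (path_len W) <= \sum_(V <- Ws) P (path_len V).
Proof.
move=> Psub; elim=> {Ws W} [W|W x Ws W' _ IH] /=.
  by rewrite andbT big_seq1 => /andP[_ /path_len_ge0].
case/andP=> /andP[_ /path_len_ge0 a0] /IH[b0 hb].
rewrite path_len_cat big_cons; split; first exact: addr_ge0.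
move: (path_len (rcons W x)) (path_len (x :: W')) a0 b0 hb => a b a0 b0 hb.
have := P0 a0; have := P0 b0.
have [a_gt0|a_le0] := ltP 0 a; last first.
  have -> : a = 0 by apply/le_anti/andP.
  by rewrite add0r; lra.
have [b_gt0|b_le0] := ltP 0 b; last first.
  have b_eq0 : b = 0 by apply/le_anti/andP.
  by rewrite b_eq0 in hb *; rewrite addr0; lra.
by have := Psub _ _ a_gt0 b_gt0; lra.
Qed.

(** The bound that makes a ticket of several pieces useless: it costs at least
    as much as the standard ticket of the path it is for. *)
Lemma ticket_price_ge W T :
  subadditive_gt0 P -> is_ticket W T -> P (path_len W) <= ticket_price p T.
Proof.
move=> Psub [aT [Ws [cW aWs iWs]]].
have [_ /le_trans -> //] := concatenation_price Psub cW aWs.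
rewrite /ticket_price {cW}.
elim: Ws T aT aWs iWs => [|V Ws IH] [|H T] //=; first by rewrite !big_nil.
move=> /andP[pH aT] /andP[pV aWs] /andP[iVH iWs].
rewrite !big_cons lerD ?IH // pP //; apply: Pincr.
  by case/andP: pV => _ /path_len_ge0.
by apply: path_len_infix => //; case/andP: pV.
Qed.

Lemma standard_ticket_is_ticket W : is_path W -> is_ticket W (@standard_ticket R N W).
Proof.
move=> pW; split; rewrite /= ?pW //; exists [:: W].
by split; rewrite /= ?pW ?infix_refl //; exact: Concat1.
Qed.

Section Shortest.
Variables (x y : N) (W : seq N).
Hypotheses (xWy : is_path_between x y W)
  (minW : forall W', is_path_between x y W' -> path_len W <= path_len W').

Let between_path V : is_path_between x y V -> is_path V.
Proof. by case/and3P. Qed.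

Lemma price_shortest W' : is_path_between x y W' -> P (path_len W) <= P (path_len W').
Proof.
move=> xW'y; apply: Pincr; last exact: minW.
by case/andP: (between_path xWy) => _ /path_len_ge0.
Qed.

Lemma shortest_cheapest_path : cheapest_path p x y W.
Proof.
split=> // W' xW'y; rewrite !pP ?(between_path xWy) ?(between_path xW'y) //.
exact: price_shortest.
Qed.

Lemma shortest_cheapest_standard_ticket :
  cheapest_standard_ticket p x y (@standard_ticket R N W).
Proof.
split; first by exists W.
by move=> W' /(proj2 shortest_cheapest_path); rewrite /ticket_price !big_seq1.
Qed.

Lemma shortest_cheapest_ticket :
  subadditive_gt0 P -> cheapest_ticket p x y (@standard_ticket R N W).
Proof.
move=> Psub; split.
  by exists W => //; apply: standard_ticket_is_ticket; apply: between_path.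
move=> W' T' xW'y /(ticket_price_ge Psub); apply: le_trans.
by rewrite /ticket_price big_seq1 pP ?price_shortest ?between_path.
Qed.

End Shortest.
End Tickets.

(** * Bellman-Ford labels *)

Section Labels.
Variables (R : realType) (N : ptn R) (y : N).
Implicit Types (u v w : N) (s : seq N).

(** The label of a node is a tentative distance to [y] and the next node on a
    path to [y]; it is [None] until such a path has been found. *)
Definition labelling := N -> option (R * N).
Implicit Types lab : labelling.

Definition dist lab u : R := if lab u is Some dv then dv.1 else 0.

(** Following successors stops at [y], so that its label may point to itself. *)
Definition init_labels : labelling := fun u => if u == y then Some (0, y) else None.

Definition improves lab u v : bool :=
  lab v && ~~ (lab u && (dist lab u <= dist lab v + len u v)).

Definition relax lab (a : N * N) : labelling :=
  if improves lab a.1 a.2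
  then fun u => if u == a.1 then Some (dist lab a.2 + len a.1 a.2, a.2) else lab u
  else lab.

Definition relax_all lab : labelling := foldl relax lab (arcs N).

(** The invariant of relaxation. The last inequality is not an equality, since
    the label of the successor may decrease later on. *)
Record sound lab : Prop := Sound {
  sound_target : lab y = Some (0, y);
  sound_step : forall u d v, u != y -> lab u = Some (d, v) ->
    [/\ 0 < d, adj u v, lab v : bool & dist lab v + len u v <= d] }.

(** Unlike [dist lab u = r], this is stable under relaxation. *)
Definition below lab u (r : R) : bool := lab u && (dist lab u <= r).

Lemma relax_below lab a u r : below lab u r -> below (relax lab a) u r.
Proof.
rewrite /below /relax; case: ifP => // imp /andP[lu du].
rewrite /dist /=; case: eqP => [e|_]; last by rewrite lu.
move: imp; rewrite /improves -e lu /= -ltNge => /andP[_ h].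
by rewrite (le_trans _ du) // ltW.
Qed.

Lemma relax_arc lab u v r : below lab v r -> below (relax lab (u, v)) u (r + len u v).
Proof.
rewrite /below /relax => /andP[lv dv] /=; case: ifP => [_|].
  by rewrite /dist /= eqxx /= lerD2r.
move/negbT; rewrite /improves lv /= negbK => /andP[-> h].
by rewrite (le_trans h) ?lerD2r.
Qed.

Lemma mem_arcs a : (a \in arcs N) = adj a.1 a.2.
Proof. by rewrite mem_filter mem_enum andbT. Qed.

Lemma foldl_relax_below (l : seq (N * N)) lab u r :
  below lab u r -> below (foldl relax lab l) u r.
Proof. by elim: l lab => //= a l IH lab /(relax_below a)/IH. Qed.

(** The relaxations before that of [(u, v)] keep the bound at [v], and those
    after it keep the bound at [u]. *)
Lemma relax_all_arc lab u v r :
  adj u v -> below lab v r -> below (relax_all lab) u (r + len u v).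
Proof.
move=> auv hv; have : (u, v) \in arcs N by rewrite mem_arcs.
rewrite /relax_all => /splitPr[l1 l2].
by rewrite foldl_cat /=; apply/foldl_relax_below/relax_arc/foldl_relax_below.
Qed.

(** The walk without its first arc is covered by the first [k] rounds, and its
    first arc by the round after them. *)
Lemma iter_relax_below k u s :
  path (@adj R N) u s -> last u s = y -> (size s <= k)%N ->
  below (iter k relax_all init_labels) u (path_len (u :: s)).
Proof.
elim: k u s => [|k IH] u [|v s] //=.
- by move=> _ -> _; rewrite path_len1 /below /dist /init_labels eqxx lexx.
- move=> _ uy _; apply: foldl_relax_below; exact: (IH u [::]).
- case/andP=> auv pv lv sk; rewrite path_len_cons addrC.
  exact/relax_all_arc/IH.
Qed.

Lemma sound_dist_gt0 lab u : sound lab -> u != y -> lab u -> 0 < dist lab u.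
Proof.
move=> S uy; rewrite /dist; case e: (lab u) => [[d v]|] // _.
by have [] := sound_step S uy e.
Qed.

Lemma sound_dist_ge0 lab u : sound lab -> 0 <= dist lab u.
Proof.
move=> S; have [->|uy] := eqVneq u y; first by rewrite /dist (sound_target S).
case e: (lab u : bool); first exact/ltW/sound_dist_gt0.
by rewrite /dist; case: (lab u) e.
Qed.

Lemma sound_init : sound init_labels.
Proof.
split=> [|u d v uy]; rewrite /init_labels ?eqxx //.
by rewrite (negbTE uy).
Qed.

(** Relaxing an arc leaves the label of [y] alone, as [0] cannot be improved by
    a sum of nonnegative numbers. All other labels can only decrease, so the
    inequalities for nodes whose successor is updated are preserved. *)
Lemma sound_relax lab a : adj a.1 a.2 -> sound lab -> sound (relax lab a).
Proof.
case: a => u v /= auv S; rewrite /relax /=; case: ifP => // imp.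
set lab' := (fun _ => _).
have luv0 : 0 < len u v by exact: len_gt0.
case/andP: (imp) => lv hu.
have dv0 := sound_dist_ge0 v S.
have uy : u != y.
  apply: contraNneq hu => uy.
  have -> : dist lab u = 0 by rewrite uy /dist (sound_target S).
  by apply/andP; split; [rewrite uy (sound_target S) | apply: addr_ge0 => //; apply: ltW].
have down w : lab w -> lab' w /\ dist lab' w <= dist lab w.
  rewrite /lab' /dist /=; case: eqP => [->|_] // lu; split => //=.
  by move: hu; rewrite lu /= -ltNge => /ltW.
split; first by rewrite /lab' /= eq_sym (negbTE uy) (sound_target S).
move=> w d z wy; rewrite {1}/lab' /=; case: eqP => [->|_] e.
  case: e => <- <-; have [h1 h2] := down _ lv.
  by split=> //; [lra | rewrite lerD2r].
have [d0 awz lz hd] := sound_step S wy e.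
by have [h1 h2] := down _ lz; split=> //; lra.
Qed.

Lemma sound_relax_all lab : sound lab -> sound (relax_all lab).
Proof.
rewrite /relax_all; have: all (fun a => adj a.1 a.2) (arcs N) by apply: filter_all.
by elim: (arcs N) lab => //= a l IH lab /andP[ha hl] /(sound_relax ha)/IH; apply.
Qed.

(** A step from [u] to [v] that the program makes when it follows successors; it
    stops at distance [0]. *)
Definition follows lab u v : bool :=
  [&& lab u == Some (dist lab u, v) & 0 < dist lab u].

(** Induction on the number of nodes with a smaller label, which decreases from
    a node to its successor. As a node is not counted for itself, this number
    also gives the strict bound on the number of steps. *)
Lemma successor_path lab u : sound lab -> lab u ->
  exists s, [/\ path (@adj R N) u s, last u s = y, (size s < #|N|)%N,
    path_len (u :: s) <= dist lab u & path (follows lab) u s].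
Proof.
move=> S lu.
pose closer w := [set z | dist lab z < dist lab w].
suff [s [h1 h2 h3 h4 h5]] : exists s, [/\ path (@adj R N) u s, last u s = y,
    (size s <= #|closer u|)%N,
    path_len (u :: s) <= dist lab u & path (follows lab) u s].
  exists s; split=> //; apply: (leq_ltn_trans h3).
  rewrite -cardsT; apply/proper_card/properP; split; first exact: subsetT.
  by exists u; rewrite ?inE ?ltxx.
have [k hk] := ubnP #|closer u|.
elim: k u lu hk => // k IH u lu hk.
have [uy|uy] := eqVneq u y.
  by exists [::]; rewrite /= path_len1 sound_dist_ge0.
case e: (lab u) lu => [[d v]|] // _.
have [d0 auv lv hd] := sound_step S uy e.
have du : dist lab u = d by rewrite /dist e.
have l0 : 0 < len u v by exact: len_gt0.
have cl : (#|closer v| < #|closer u|)%N.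
  apply/proper_card/properP; split.
    by apply/subsetP => z; rewrite !inE du; lra.
  by exists v; rewrite !inE ?du ?ltxx //; lra.
have [|s [h1 h2 h3 h4 h5]] := IH v lv; first lia.
exists (v :: s); split=> //=; rewrite ?auv //.
- exact: leq_ltn_trans h3 cl.
- by rewrite path_len_cons du; lra.
- by rewrite h5 /follows e du eqxx d0.
Qed.

Definition final_labels : labelling := iter #|N| relax_all init_labels.

Lemma sound_final : sound final_labels.
Proof.
rewrite /final_labels; elim: #|N| => [|k IH]; first exact: sound_init.
exact: sound_relax_all.
Qed.

(** A walk without loops has at most [#|N|] nodes. *)
Lemma final_below u W : is_path_between u y W -> below final_labels u (path_len W).
Proof.
case/is_path_betweenP=> s [-> ps ls].
have [s' [ps' ls' us' hs']] := simple_shorter_path ps.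
have ss' : (size s' <= #|N|)%N.
  by rewrite ltnW // -[(size s').+1]/(size (u :: s')) -(card_uniqP us') max_card.
have /andP[lu du] := iter_relax_below ps' (etrans ls' ls) ss'.
by rewrite /below lu (le_trans du).
Qed.

(** The network is connected. *)
Lemma final_labelled u : final_labels u.
Proof.
have /connectP[s ps ls] := adj_connected u y.
have /final_below/andP[] // : is_path_between u y (u :: s).
by apply/is_path_betweenP; exists s.
Qed.

End Labels.

(** * Running programs within a time bound *)

Section Runs.
Variable R : realType.
Implicit Types (s : state R) (Q : state R -> Prop) (b : bexp) (c : program).

(** Total correctness: [c] halts within [T] steps in a state satisfying [Q].
    The rules for assignments allow any positive bound, to spare later uses of
    [runs_weaken]. *)
Definition runs c s T Q : Prop :=
  exists t s', [/\ exec c s t s', (t <= T)%N & Q s'].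

Lemma runs_skip s T Q : Q s -> runs Skip s T.+1 Q.
Proof. by exists 1%N, s; split=> //; constructor. Qed.

Lemma runs_nstore a e s T Q :
  Q (State [eta nmem s with neval s a |-> neval s e] (rmem s)) ->
  runs (NStore a e) s T.+1 Q.
Proof. by move=> q; do 2 eexists; split; [constructor | | exact: q]. Qed.

Lemma runs_rstore a e s T Q :
  Q (State (nmem s) [eta rmem s with neval s a |-> reval s e]) ->
  runs (RStore a e) s T.+1 Q.
Proof. by move=> q; do 2 eexists; split; [constructor | | exact: q]. Qed.

Lemma runs_seq c1 c2 s T1 T2 Q :
  runs c1 s T1 (fun s1 => runs c2 s1 T2 Q) -> runs (Seq c1 c2) s (T1 + T2) Q.
Proof.
case=> t1 [s1 [e1 h1 [t2 [s2 [e2 h2 q]]]]]; exists (t1 + t2)%N, s2.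
by split=> //; [apply: ExSeq e1 e2 | apply: leq_add].
Qed.

Lemma runs_if b c1 c2 s T Q :
  (beval s b -> runs c1 s T Q) -> (~~ beval s b -> runs c2 s T Q) ->
  runs (If b c1 c2) s T.+1 Q.
Proof.
move=> h1 h2; case e: (beval s b).
  have [t [s' [e' le q]]] := h1 e.
  by exists t.+1, s'; split=> //; apply: ExIfTrue.
have [t [s' [e' le q]]] := h2 (negbT e).
by exists t.+1, s'; split=> //; apply: ExIfFalse; rewrite ?e.
Qed.

(** A loop with a known number [K] of iterations; the invariant [I] is indexed
    by the number of iterations done. *)
Lemma runs_while b c (I : nat -> state R -> Prop) K T s :
  I 0%N s ->
  (forall j s1, (j < K)%N -> I j s1 -> beval s1 b /\ runs c s1 T (I j.+1)) ->
  (forall s1, I K s1 -> ~~ beval s1 b) ->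
  runs (While b c) s (K * T.+1).+1 (I K).
Proof.
move=> I0 step stop.
suff H k j s1 : (j + k)%N = K -> I j s1 -> runs (While b c) s1 (k * T.+1).+1 (I K).
  exact: (H K 0%N).
elim: k j s1 => [|k IH] j s1 jk Ij.
  rewrite addn0 in jk; subst j; exists 1%N, s1; split=> //.
  exact/ExWhileFalse/stop.
have [|bt [t1 [s2 [e1 h1 I2]]]] := step j s1 _ Ij; first lia.
have [|t2 [s3 [e2 h2 I3]]] := IH j.+1 s2 _ I2; first lia.
exists (t1 + t2).+1, s3; split=> //; first exact: ExWhileTrue e1 e2.
by rewrite mulSn ltnS; lia.
Qed.

Lemma runs_weaken c s T T' Q Q' :
  runs c s T Q -> (T <= T')%N -> (forall s', Q s' -> Q' s') -> runs c s T' Q'.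
Proof.
move=> [t [s' [e h q]]] le sub; exists t, s'; split=> //; last exact: sub.
exact: leq_trans le.
Qed.

End Runs.

(** * The shortest path program *)

(** The input occupies the memory of natural numbers from address [0] on, so
    that no fixed address is free for registers. The working area starts at
    [base = 4 + #|N| + 2 * #|arcs|]: beyond the input, and beyond the output as
    well, whose [#|N| + 2] cells at most may thus overwrite the input. Once
    initialized, cell [0] holds [base] until the last instruction. In the working area, offsets [0]
    to [3] are registers, and offset [4 + u] holds the mark of node [u]: [0] if
    [u] has no label, and [v + 1] if its successor is [v]. In the memory of
    reals, address [base + u] holds the distance label of [u].

    The state starts with zeros beyond the input, which are the right initial
    values for the distance of the target, the other marks and the output
    counter. *)
Definition ncell k : nexp := NLoad (NConst k).

Definition reg_addr k : nexp := NAdd (ncell 0) (NConst k).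

Definition round_reg := reg_addr 0.
Definition arc_reg := reg_addr 1.
Definition node_reg := reg_addr 2.
Definition count_reg := reg_addr 3.

Definition mark_addr e : nexp := NAdd (reg_addr 4) e.

Definition dist_addr e : nexp := NAdd (ncell 0) e.

Definition arc_tail : nexp :=
  NLoad (NAdd (NConst 4) (NAdd (NLoad arc_reg) (NLoad arc_reg))).
Definition arc_head : nexp :=
  NLoad (NAdd (NConst 5) (NAdd (NLoad arc_reg) (NLoad arc_reg))).

Definition via_arc : rexp :=
  RAdd (RLoad (dist_addr arc_head)) (RLoad (NLoad arc_reg)).

Definition marked e : bexp := BNLe (NConst 1) (NLoad (mark_addr e)).

Definition improves_test : bexp :=
  BAnd (marked arc_head)
       (BNot (BAnd (marked arc_tail) (BRLe (RLoad (dist_addr arc_tail)) via_arc))).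

Definition relax_arc_prog : program :=
  Seq (If improves_test
         (Seq (NStore (mark_addr arc_tail) (NAdd arc_head (NConst 1)))
              (RStore (dist_addr arc_tail) via_arc))
         Skip)
      (NStore arc_reg (NAdd (NLoad arc_reg) (NConst 1))).

Definition relax_all_prog : program :=
  Seq (NStore arc_reg (NConst 0))
      (While (BNLe (NAdd (NLoad arc_reg) (NConst 1)) (ncell 1)) relax_arc_prog).

Definition label_prog : program :=
  While (BNLe (NConst 1) (NLoad round_reg))
    (Seq relax_all_prog (NStore round_reg (NSub (NLoad round_reg) (NConst 1)))).

Definition base_exp : nexp :=
  NAdd (NConst 4) (NAdd (ncell 0) (NAdd (ncell 1) (ncell 1))).

(** The number of nodes moves to the round register before cell [0], which
    [base_exp] reads, is overwritten by the base. *)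
Definition init_prog : program :=
  Seq (NStore base_exp (ncell 0))
  (Seq (NStore (NConst 0) base_exp)
       (NStore (mark_addr (ncell 3)) (NAdd (ncell 3) (NConst 1)))).

Definition emit_node o : program :=
  NStore (NAdd (NConst o) (NLoad count_reg)) (NLoad node_reg).

Definition incr_count : program :=
  NStore count_reg (NAdd (NLoad count_reg) (NConst 1)).

(** The target is recognized as the only node at distance [0]. *)
Definition follow_prog o : program :=
  While (BNot (BRLe (RLoad (dist_addr (NLoad node_reg))) RZero))
    (Seq (emit_node o)
    (Seq incr_count
         (NStore node_reg (NSub (NLoad (mark_addr (NLoad node_reg))) (NConst 1))))).

(** The nodes of the path are written from address [o] on, which leaves room for
    the header of the output. *)
Definition search_prog o : program :=
  Seq init_prog
  (Seq label_prog
  (Seq (NStore node_reg (ncell 2))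
  (Seq (follow_prog o)
  (Seq (emit_node o) incr_count)))).

Definition path_prog : program :=
  Seq (search_prog 1) (NStore (NConst 0) (NLoad count_reg)).

(** A standard ticket is coded as the number [1] of its paths, followed by the
    code of the path. *)
Definition ticket_prog : program :=
  Seq (search_prog 2)
  (Seq (NStore (NConst 1) (NLoad count_reg)) (NStore (NConst 0) (NConst 1))).

(** * Correctness and running time of the program *)

Section Correctness.
Variables (R : realType) (N : ptn R) (x y : N).
Implicit Types (u v : N) (s : state R) (lab : labelling N).

Let n := #|N|.
Let m := size (arcs N).
Let arc i := nth (x, x) (arcs N) i.
Definition base : nat := (4 + (n + (m + m)))%N.
Arguments base : simpl never.

Definition mark lab u : nat := if lab u is Some dv then (node_code dv.2).+1 else 0.

(** What the memory contains while labels are being corrected. The registers for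
    rounds, arcs and nodes are left out, as they change at their own pace. *)
Record stored lab s : Prop := Stored {
  stored_base : nmem s 0 = base;
  stored_size : nmem s 1 = m;
  stored_source : nmem s 2 = node_code x;
  stored_tail : forall i, (i < m)%N -> nmem s (4 + (i + i)) = node_code (arc i).1;
  stored_head : forall i, (i < m)%N -> nmem s (5 + (i + i)) = node_code (arc i).2;
  stored_len : forall i, (i < m)%N -> rmem s i = len (arc i).1 (arc i).2;
  stored_count : nmem s (base + 3) = 0%N;
  stored_mark : forall u, nmem s (base + 4 + node_code u) = mark lab u;
  stored_dist : forall u, lab u -> rmem s (base + node_code u) = dist lab u }.

Lemma node_code_lt u : (node_code u < n)%N.
Proof. exact: ltn_ord. Qed.

Lemma node_code_eq u v : (node_code u == node_code v) = (u == v).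
Proof. by rewrite /node_code (inj_eq val_inj) (inj_eq enum_rank_inj). Qed.

Lemma mark_gt0 lab u : (0 < mark lab u)%N = lab u :> bool.
Proof. by rewrite /mark; case: (lab u). Qed.

Lemma stored_register lab s r e :
  (r < 3)%N -> stored lab s ->
  stored lab (State [eta nmem s with (base + r)%N |-> e] (rmem s)).
Proof.
move=> r3 [h0 h1 h2 h3 h4 h5 h6 h7 h8]; split=> //=.
- by move=> i im; rewrite ifN ?h3 //; apply/eqP; rewrite /base; lia.
- by move=> i im; rewrite ifN ?h4 //; apply/eqP; rewrite /base; lia.
- by rewrite ifN //; apply/eqP; lia.
- by move=> u; rewrite ifN ?h7 //; apply/eqP; lia.
Qed.

Lemma stored_update lab s u v d :
  stored lab s ->
  stored (fun w => if w == u then Some (d, v) else lab w)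
    (State [eta nmem s with (base + 4 + node_code u)%N |-> (node_code v).+1]
           [eta rmem s with (base + node_code u)%N |-> d]).
Proof.
case=> h0 h1 h2 h3 h4 h5 h6 h7 h8; have un := node_code_lt u; split=> //=.
- by move=> i im; rewrite ifN ?h3 //; apply/eqP; rewrite /base; lia.
- by move=> i im; rewrite ifN ?h4 //; apply/eqP; rewrite /base; lia.
- by move=> i im; rewrite ifN ?h5 //; apply/eqP; rewrite /base; lia.
- by rewrite ifN //; apply/eqP; lia.
- by move=> w; rewrite /mark eqn_add2l node_code_eq; case: eqP => [//|_]; apply: h7.
- by move=> w; rewrite /dist eqn_add2l node_code_eq; case: eqP => [//|_]; apply: h8.
Qed.

Lemma improves_testE lab s i :
  (i < m)%N -> stored lab s -> nmem s (base + 1) = i ->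
  beval s improves_test = improves lab (arc i).1 (arc i).2.
Proof.
move=> im S hi; have [h0 _ _ h3 h4 h5 _ h7 h8] := S.
rewrite /improves_test /= !h0 hi !(h3 _ im) !(h4 _ im) !(h5 _ im) !h7 !mark_gt0 /improves.
case lv: (lab (arc i).2 : bool) => //=.
by rewrite (h8 (arc i).2) ?lv //; case lu: (lab (arc i).1 : bool) => //=; rewrite h8 ?lu.
Qed.

Lemma relax_arc_prog_runs lab s i k :
  (i < m)%N -> stored lab s -> nmem s (base + 1) = i -> nmem s (base + 0) = k ->
  runs relax_arc_prog s 4 (fun s' =>
    [/\ stored (relax lab (arc i)) s', nmem s' (base + 1) = i.+1
      & nmem s' (base + 0) = k]).
Proof.
move=> im S hi hk; apply: (@runs_seq _ _ _ _ 3 1).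
have := improves_testE im S hi; have [h0 _ _ h3 h4 h5 _ h7 h8] := S.
(* Both branches of the test are followed by the increment of the arc index. *)
suff next s1 : stored (relax lab (arc i)) s1 -> nmem s1 (base + 1) = i ->
    nmem s1 (base + 0) = k -> runs (NStore arc_reg (NAdd (NLoad arc_reg) (NConst 1)))
      s1 1 (fun s' => [/\ stored (relax lab (arc i)) s', nmem s' (base + 1) = i.+1
      & nmem s' (base + 0) = k]).
  move=> test; apply: runs_if; rewrite test => imp.
    apply: (@runs_seq _ _ _ _ 1 1); apply: runs_nstore; apply: runs_rstore.
    have un := node_code_lt (arc i).1; have vn := node_code_lt (arc i).2.
    have lv : lab (arc i).2 by case/andP: imp.
    have ne0 a : (0 == base + 4 + a)%N = false by apply/eqP; lia.
    have ne1 a : (base + 1 == base + 4 + a)%N = false by apply/eqP; lia.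
    have ne2 a : (base + 0 == base + 4 + a)%N = false by apply/eqP; lia.
    have ne3 a : (4 + (i + i) == base + 4 + a)%N = false by apply/eqP; rewrite /base; lia.
    have ne4 a : (5 + (i + i) == base + 4 + a)%N = false by apply/eqP; rewrite /base; lia.
    apply: next; rewrite /= ?h0 ?hi ?(h3 _ im) ?(h4 _ im) ?(h5 _ im)
      !(ne0, ne1, ne2, ne3, ne4) ?h0 ?hi //.
    rewrite ?(ne0, ne1, ne2, ne3, ne4) ?(h3 _ im) ?(h4 _ im) ?(h5 _ im) h8 //.
    rewrite /relax imp addn1; exact: stored_update.
  by apply: runs_skip; apply: next; rewrite // /relax (negbTE imp).
move=> S1 hi1 hk1; apply: runs_nstore; rewrite /= (stored_base S1) hi1; split.
- exact: stored_register.
- by rewrite eqxx addn1.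
- by rewrite ifN //; apply/eqP; lia.
Qed.

Lemma relax_all_prog_runs lab s k :
  stored lab s -> nmem s (base + 0) = k ->
  runs relax_all_prog s (1 + (m * 5).+1) (fun s' =>
    stored (relax_all lab) s' /\ nmem s' (base + 0) = k).
Proof.
move=> S hk; apply: runs_seq; apply: runs_nstore; rewrite /= (stored_base S).
pose I i s1 := [/\ stored (foldl (@relax R N) lab (take i (arcs N))) s1,
  nmem s1 (base + 1) = i & nmem s1 (base + 0) = k].
apply: (@runs_weaken _ _ _ (m * 5).+1 _ (I m)) => //; last first.
  by move=> s'; rewrite /I take_size => -[].
apply: (@runs_while _ _ _ I m 4).
- rewrite /I take0 /=; split; [exact: stored_register | by rewrite eqxx |].
  by rewrite ifN //; apply/eqP; lia.
- move=> i s1 im [S1 hi1 hk1]; split.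
    by rewrite /= (stored_base S1) hi1 (stored_size S1) addn1.
  rewrite /I (take_nth (x, x)) // foldl_rcons.
  exact: relax_arc_prog_runs.
- by move=> s1 [S1 hi1 _]; rewrite /= (stored_base S1) hi1 (stored_size S1) addn1 ltnn.
Qed.

Lemma label_prog_runs s :
  stored (init_labels y) s -> nmem s (base + 0) = n ->
  runs label_prog s (n * (1 + (m * 5).+1 + 1).+1).+1 (stored (final_labels y)).
Proof.
move=> S hn.
pose I j s1 := stored (iter j (@relax_all R N) (init_labels y)) s1 /\
  nmem s1 (base + 0) = (n - j)%N.
apply: (@runs_weaken _ _ _ _ _ (I n) _ _ (leqnn _)); last by move=> s' [].
apply: (@runs_while _ _ _ I n (1 + (m * 5).+1 + 1)).
- by rewrite /I subn0.
- move=> j s1 jn [S1 hk]; split; first by rewrite /= (stored_base S1) hk; lia.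
  apply: runs_seq; apply: runs_weaken (relax_all_prog_runs S1 hk) _ _ => // s2 [S2 hk2].
  apply: runs_nstore; rewrite /= (stored_base S2) hk2 /I /=; split.
    exact: stored_register.
  by rewrite eqxx; lia.
- by move=> s1 [S1 hk]; rewrite /= (stored_base S1) hk subnn.
Qed.

Lemma nth_flatten_pairs (l : seq (N * N)) i :
  (i < size l)%N ->
  let f := flatten [seq [:: node_code a.1; node_code a.2] | a <- l] in
  nth 0%N f (i + i) = node_code (nth (x, x) l i).1 /\
  nth 0%N f (i + i).+1 = node_code (nth (x, x) l i).2.
Proof.
elim: l i => //= a l IH [|i] //= /IH.
by rewrite addnS.
Qed.

Lemma size_flatten_pairs (l : seq (N * N)) :
  size (flatten [seq [:: node_code a.1; node_code a.2] | a <- l]) = (size l + size l)%N.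
Proof. by elim: l => //= a l ->; rewrite addnS. Qed.

(** The states after each of the three stores are abstracted into the few facts
    that are needed of them. *)
Lemma init_prog_runs :
  runs init_prog (input_state x y) 3 (fun s =>
    stored (init_labels y) s /\ nmem s (base + 0) = n).
Proof.
have blank i : (base <= i)%N -> nmem (input_state x y) i = 0%N.
  move=> bi; rewrite [LHS]nth_default // size_cat size_flatten_pairs.
  by move: bi; rewrite /base /=; lia.
have rblank i : (m <= i)%N -> rmem (input_state x y) i = 0.
  by move=> mi; rewrite [LHS]nth_default // size_map.
have flat i : (i < m)%N ->
    nmem (input_state x y) (4 + (i + i)) = node_code (arc i).1 /\
    nmem (input_state x y) (5 + (i + i)) = node_code (arc i).2.
  by move=> im; exact: nth_flatten_pairs.
have rlen i : (i < m)%N -> rmem (input_state x y) i = len (arc i).1 (arc i).2.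
  by move=> im; rewrite [LHS](nth_map (x, x)).
have c0 : nmem (input_state x y) 0 = n by [].
have c1 : nmem (input_state x y) 1 = m by [].
have c2 : nmem (input_state x y) 2 = node_code x by [].
have c3 : nmem (input_state x y) 3 = node_code y by [].
move: (input_state x y) blank rblank flat rlen c0 c1 c2 c3.
move=> s blank rblank flat rlen c0 c1 c2 c3.
apply: (@runs_seq _ _ _ _ 1 2); apply: runs_nstore.
have -> : neval s base_exp = base by rewrite /= c0 c1.
set s1 := State _ _.
have s1E i : i != base -> nmem s1 i = nmem s i by rewrite /= => /negbTE->.
have s1b : nmem s1 base = n by rewrite /= eqxx.
have r1E : rmem s1 = rmem s by [].
move: s1 s1E s1b r1E => s1 s1E s1b r1E.
apply: (@runs_seq _ _ _ _ 1 1); apply: runs_nstore; rewrite r1E.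
have -> : neval s1 base_exp = base by rewrite /= !s1E // c0 c1.
rewrite [neval s1 _]/=.
set s2 := State _ _.
have s2E i : i != 0%N -> nmem s2 i = nmem s1 i by rewrite /= => /negbTE->.
have s20 : nmem s2 0 = base by [].
have r2E : rmem s2 = rmem s by [].
move: s2 s2E s20 r2E => s2 s2E s20 r2E.
apply: runs_nstore.
have s23 : nmem s2 3 = node_code y by rewrite s2E // s1E.
have -> : neval s2 (mark_addr (ncell 3)) = (base + 4 + node_code y)%N.
  by rewrite /= s20 s23.
have -> : neval s2 (NAdd (ncell 3) (NConst 1)) = (node_code y).+1.
  by rewrite /= s23 addn1.
have s2s i : (0 < i)%N -> i != base -> nmem s2 i = nmem s i.
  by move=> i0 ib; rewrite s2E ?s1E // -lt0n.
rewrite r2E; split; last first.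
  by rewrite /= ifN; [rewrite addn0 s2E | apply/eqP; lia].
split=> //=.
- by rewrite s2s.
- by rewrite s2s.
- move=> i im; have [f _] := flat i im.
  by rewrite ifN ?s2s //; apply/eqP; rewrite /base; lia.
- move=> i im; have [_ f] := flat i im.
  by rewrite ifN ?s2s //; apply/eqP; rewrite /base; lia.
- by rewrite ifN ?s2s ?blank ?leq_addr //; apply/eqP; lia.
- move=> u; rewrite eqn_add2l node_code_eq /mark /init_labels.
  case: eqP => [_|uy] //.
  by rewrite s2s ?blank // -?addnA ?leq_addr //; apply/eqP; rewrite /base; lia.
- move=> u; rewrite /dist /init_labels; case: eqP => // _ _.
  by rewrite rblank // /base; lia.
Qed.

(** The output may overwrite the arcs, so the invariant of this loop keeps only
    the base, the registers and the labels. The last node of [W] is left to be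
    written after the loop. *)
Lemma follow_prog_runs o lab s u W :
  sound y lab -> stored lab s -> (0 < o <= 2)%N -> (size W < n)%N ->
  path (follows lab) u W -> last u W = y -> nmem s (base + 2) = node_code u ->
  runs (follow_prog o) s (size W * 4).+1 (fun s' =>
    [/\ nmem s' 0 = base, nmem s' (base + 3) = size W,
        nmem s' (base + 2) = node_code y
      & forall i, (i < size W)%N -> nmem s' (o + i) = node_code (nth u (u :: W) i)]).
Proof.
move=> Sd S /andP[o0 o2] Wn pW lW hu.
pose I j s1 := [/\ nmem s1 0 = base /\ nmem s1 (base + 3) = j,
  nmem s1 (base + 2) = node_code (nth u (u :: W) j),
  forall v, nmem s1 (base + 4 + node_code v) = mark lab v,
  forall v, lab v -> rmem s1 (base + node_code v) = dist lab v
  & forall i, (i < j)%N -> nmem s1 (o + i) = node_code (nth u (u :: W) i)].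
have yW : nth u (u :: W) (size W) = y by rewrite -lW nth_last.
apply: (@runs_weaken _ _ _ _ _ (I (size W)) _ _ (leqnn _)); last first.
  by move=> s' [[h0 h1] h2 _ _ h3]; rewrite yW in h2.
apply: (@runs_while _ _ _ I (size W) 3).
- by have [h0 _ _ _ _ _ h6 h7 h8] := S.
- move=> j s1 jW [[h0 h3] h2 h7 h8 hW].
  have /(pathP u)/(_ j jW) := pW; set v := nth u (u :: W) j => /andP[/eqP lv dv].
  have vn := node_code_lt v.
  split; first by rewrite /= h0 h2 h8 ?lv // -ltNge.
  apply: (@runs_seq _ _ _ _ 1 2); apply: runs_nstore; rewrite /= h0 h3 h2.
  set s2 := State _ _.
  have s2E i : i != (o + j)%N -> nmem s2 i = nmem s1 i by rewrite /= => /negbTE->.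
  have s2o : nmem s2 (o + j) = node_code v by rewrite /= eqxx.
  have r2E : rmem s2 = rmem s1 by [].
  move: s2 s2E s2o r2E => s2 s2E s2o r2E.
  have s2b i : (base <= i)%N -> nmem s2 i = nmem s1 i.
    by move=> bi; rewrite s2E //; apply/eqP; move: bi; rewrite /base; lia.
  have s20 : nmem s2 0 = base by rewrite s2E //; apply/eqP; lia.
  apply: (@runs_seq _ _ _ _ 1 1); apply: runs_nstore; rewrite /= s20 s2b ?leq_addr // h3.
  set s3 := State _ _.
  have s3E i : i != (base + 3)%N -> nmem s3 i = nmem s2 i by rewrite /= => /negbTE->.
  have s33 : nmem s3 (base + 3) = j.+1 by rewrite /= eqxx addn1.
  have r3E : rmem s3 = rmem s1 by [].
  move: s3 s3E s33 r3E => s3 s3E s33 r3E.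
  have s30 : nmem s3 0 = base by rewrite s3E //; apply/eqP; lia.
  have s32 : nmem s3 (base + 2) = node_code v.
    by rewrite s3E ?s2b ?leq_addr //; apply/eqP; lia.
  have s34 w : nmem s3 (base + 4 + node_code w) = mark lab w.
    by rewrite s3E; [rewrite s2b ?h7 // -addnA leq_addr | apply/eqP; lia].
  apply: runs_nstore; rewrite /= s30 s32 s34 /mark lv /= subn1 /=.
  have far i : (o + i < base)%N -> nmem s3 (o + i) = nmem s2 (o + i).
    by move=> ib; rewrite s3E //; apply/eqP; lia.
  split=> /=.
  + by split=> //; rewrite ifN //; apply/eqP; lia.
  + by rewrite eqxx.
  + by move=> w; rewrite ifN ?s34 //; apply/eqP; lia.
  + by rewrite r3E.
  + move=> i ij; have ib : (o + i < base)%N by rewrite /base; lia.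
    rewrite ifN ?far //; last by apply/eqP; lia.
    move: ij; rewrite ltnS leq_eqVlt => /predU1P[->|ij]; first exact: s2o.
    by rewrite s2E ?hW //; apply/eqP; lia.
- move=> s1 [[h0 _] h2 _ h8 _]; rewrite /= h0 h2 yW h8 /dist (sound_target Sd) //=.
  by rewrite negbK.
Qed.

Definition search_time : nat :=
  3 + ((n * (1 + (m * 5).+1 + 1).+1).+1 + (1 + ((n * 4).+1 + 2))).

Lemma search_prog_runs o :
  (0 < o <= 2)%N ->
  exists W, [/\ is_path_between x y W,
    forall W', is_path_between x y W' -> path_len W <= path_len W'
  & runs (search_prog o) (input_state x y) search_time (fun s =>
      [/\ nmem s 0 = base, nmem s (base + 3) = size W
        & forall i, (i < size W)%N ->
            nmem s (o + i) = nth 0%N (map (@node_code R N) W) i])].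
Proof.
move=> o12; have Sd := sound_final y.
have [s [ps ls ss hs fs]] := successor_path Sd (final_labelled y x).
exists (x :: s); split.
- by apply/is_path_betweenP; exists s.
- move=> W' /final_below/andP[_]; exact: le_trans.
rewrite /search_time; apply: runs_seq.
apply: (runs_weaken init_prog_runs) => // s1 [S1 hn].
apply: runs_seq; apply: (runs_weaken (label_prog_runs S1 hn)) => // s2 S2.
apply: runs_seq; apply: runs_nstore.
rewrite /= (stored_base S2) (stored_source S2).
set s3 := State _ _.
have S3 : stored (final_labels y) s3 by exact: stored_register.
have s32 : nmem s3 (base + 2) = node_code x by rewrite /= eqxx.
apply: runs_seq.
apply: (runs_weaken (follow_prog_runs Sd S3 o12 ss fs ls s32)).
  by rewrite ltnS leq_mul2r ltnW.
move=> s4 [s40 s43 s42 s4W].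
have on : (o + size s < base)%N by move: ss o12; rewrite /base; lia.
apply: (@runs_seq _ _ _ _ 1 1); apply: runs_nstore; rewrite /= s40 s43 s42.
set s5 := State _ _.
have s5E i : i != (o + size s)%N -> nmem s5 i = nmem s4 i by rewrite /= => /negbTE->.
have s5o : nmem s5 (o + size s) = node_code y by rewrite /= eqxx.
move: s5 s5E s5o => s5 s5E s5o.
have s50 : nmem s5 0 = base by rewrite s5E //; apply/eqP; lia.
have s53 : nmem s5 (base + 3) = size s by rewrite s5E //; apply/eqP; lia.
apply: runs_nstore; rewrite /= s50 s53 addn1 eqxx; split=> //.
move=> i; rewrite ltnS => si; rewrite ifN; last by apply/eqP; lia.
rewrite -[_ :: map _ s]/(map _ (x :: s)) (nth_map x) //.
move: si; rewrite leq_eqVlt => /predU1P[->|si].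
  by rewrite s5o -[size s]/(size (x :: s)).-1 nth_last /= ls.
by rewrite s5E ?s4W //; apply/eqP; lia.
Qed.

(** The [2] bounds the time for writing the header of the output. *)
Lemma search_time_le : (search_time + 2 <= 13 * network_size N ^ 2 + 13)%N.
Proof.
rewrite /search_time /network_size -/n -/m; nia.
Qed.

Lemma path_prog_returns :
  exists W, [/\ is_path_between x y W,
    forall W', is_path_between x y W' -> path_len W <= path_len W'
  & runs path_prog (input_state x y) (search_time + 2) (fun s =>
      forall i, (i < size (path_code W))%N -> nmem s i = nth 0%N (path_code W) i)].
Proof.
have [W [hW minW run]] := @search_prog_runs 1 isT.
exists W; split=> //; apply: runs_seq; apply: (runs_weaken run) => // s [s0 s3 sW].
apply: runs_nstore; rewrite /= s0 s3 => -[|i] //.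
by rewrite ltnS size_map => /sW.
Qed.

Lemma ticket_prog_returns :
  exists W, [/\ is_path_between x y W,
    forall W', is_path_between x y W' -> path_len W <= path_len W'
  & let out := ticket_code (@standard_ticket R N W) in
    runs ticket_prog (input_state x y) (search_time + 2) (fun s =>
      forall i, (i < size out)%N -> nmem s i = nth 0%N out i)].
Proof.
have [W [hW minW run]] := @search_prog_runs 2 isT.
exists W; split=> //; apply: runs_seq; apply: (runs_weaken run) => // s [s0 s3 sW].
apply: (@runs_seq _ _ _ _ 1 1); apply: runs_nstore; apply: runs_nstore.
rewrite /= s0 s3 cats0 => -[|[|i]] //=.
by rewrite cats0 !ltnS size_map => /sW.
Qed.

End Correctness.

Lemma returns_runs (R : realType) (N : ptn R) (x y : N) c T out :
  runs c (input_state x y) T (fun s =>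
    forall i, (i < size out)%N -> nmem s i = nth 0%N out i) ->
  returns c x y out.
Proof. by case=> t [s [e _ h]]; exists t, s. Qed.

Lemma polynomial_time_runs (R : realType) c :
  (forall (N : ptn R) (x y : N), exists Q,
    runs c (input_state x y) (search_time N + 2) Q) ->
  polynomial_time R c.
Proof.
move=> h; exists 13%N, 2%N => N x y; have [Q [t [s [e le _]]]] := h N x y.
by exists t, s; split=> //; apply: leq_trans le (search_time_le N).
Qed.

Theorem corollary11 (R : realType) :
  exists path_alg standard_alg ticket_alg : program,
    [/\ polynomial_time R path_alg,
        polynomial_time R standard_alg
      & polynomial_time R ticket_alg] /\
    forall P : R -> R, price_function P -> increasing_price P ->
    forall (N : ptn R) (p : seq N -> R),
      fare_structure p -> distance_tariff P p ->
    forall x y : N,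
      [/\ exists W, returns path_alg x y (path_code W) /\
                    cheapest_path p x y W,
          exists T, returns standard_alg x y (ticket_code T) /\
                    cheapest_standard_ticket p x y T
        & subadditive_gt0 P ->
          exists T, returns ticket_alg x y (ticket_code T) /\
                    cheapest_ticket p x y T].
Proof.
have ticket_poly : polynomial_time R ticket_prog.
  apply: polynomial_time_runs => N x y.
  by have [W [_ _ run]] := ticket_prog_returns x y; eexists; exact: run.
exists path_prog, ticket_prog, ticket_prog; split.
  split=> //; apply: polynomial_time_runs => N x y.
  by have [W [_ _ run]] := path_prog_returns x y; eexists; exact: run.
move=> P P0 Pincr N p _ pP x y.
have [W [hW minW run]] := path_prog_returns x y.
have [V [hV minV run']] := ticket_prog_returns x y.
split.
- exists W; split; first exact: returns_runs run.
  exact (shortest_cheapest_path Pincr pP hW minW).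
- exists (standard_ticket V); split; first exact: returns_runs run'.
  exact (shortest_cheapest_standard_ticket Pincr pP hV minV).
- move=> Psub; exists (standard_ticket V); split; first exact: returns_runs run'.
  exact (shortest_cheapest_ticket P0 Pincr pP hV minV Psub).
Qed.
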